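(* Let $Y$ be a Banach space over $\mathbb{K}$ and $X$ a closed subspace of $Y$ such that $(X,Y)$ is a BPB-pair. Then, for every bounded and uniformly continuous function $f:S_X\longrightarrow Y$, the equality $\overline{\mathrm{co}}\,W(f)=V(f)$ holds.
   Context: $\mathbb{K}$ is $\mathbb{R}$ or $\mathbb{C}$. For a Banach space $Y$, $S_Y$ is its unit sphere and $Y^*$ its dual; for $u\in S_Y$, $D(Y,u)=\{y^*\in Y^* : \|y^*\|=y^*(u)=1\}$. Let $X$ be a closed subspace of $Y$ with inclusion $J:X\to Y$ (a linear isometry). Put $\Pi(X,Y)=\{(x,y^* )\in S_X\times S_{Y^*} : y^*\in D(Y,Jx)\}$. Let $B(S_X,Y)$ be the Banach space of all bounded functions from $S_X$ to $Y$ with the supremum norm. For $f\in B(S_X,Y)$, the spatial numerical range is $W(f)=\{y^*(f(x)) : (x,y^* )\in\Pi(X,Y)\}$ and the intrinsic numerical range is $V(f)=\{\Phi(f) : \Phi\in D(B(S_X,Y),J|_{S_X})\}$. $\overline{\mathrm{co}}$ denotes closed convex hull. The pair $(X,Y)$ is a BPB-pair (Bishop-Phelps-Bollobás pair) if for every $\varepsilon>0$ there exists $\delta>0$ such that whenever $x_0\in S_X$, $y_0^*\in S_{Y^*}$ satisfy $\mathrm{Re}\,y_0^*(x_0)>1-\delta$, there exists $(x,y^* )\in\Pi(X,Y)$ with $\|x_0-x\|<\varepsilon$ and $\|y_0^*-y^*\|<\varepsilon$. *)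

(* Defs.v *)
From HB Require Import structures.
From mathcomp Require Import all_boot all_order all_algebra.
From mathcomp Require Import complex.
From mathcomp Require Import all_classical all_reals interval_inference.
From mathcomp Require Import topology normedtype convex.

Set Implicit Arguments.
Unset Strict Implicit.
Unset Printing Implicit Defensive.

Import Order.TTheory GRing.Theory Num.Theory.
Import numFieldNormedType.Exports.

Local Open Scope classical_set_scope.
Local Open Scope ring_scope.

Variant scalars := RealScalars | ComplexScalars.

Definition scalar_field (R : realType) (s : scalars) : numFieldType :=
  match s with RealScalars => R | ComplexScalars => R[i] end.

Section Scalars.
Variables (R : realType) (s : scalars).
Local Notation K := (scalar_field R s).

Definition re : K -> R :=
  match s return scalar_field R s -> R with
  | RealScalars => idfun
  | ComplexScalars => @complex.Re R
  end.

Definition of_real : R -> K :=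
  match s return R -> scalar_field R s with
  | RealScalars => idfun
  | ComplexScalars => real_complex R
  end.

Lemma of_realK : cancel of_real re.
Proof. by rewrite /of_real /re; case: s. Qed.

Lemma of_real0 : of_real 0 = 0.
Proof. by rewrite /of_real; case: s. Qed.

Lemma of_realD x y : of_real (x + y) = of_real x + of_real y.
Proof. by rewrite /of_real; case: s => //=; exact: rmorphD. Qed.

Lemma of_realM x y : of_real (x * y) = of_real x * of_real y.
Proof. by rewrite /of_real; case: s => //=; exact: rmorphM. Qed.

Lemma ler_of_real x y : (of_real x <= of_real y) = (x <= y).
Proof. by rewrite /of_real; case: s => //=; exact: lecR. Qed.

Lemma ltr_of_real x y : (of_real x < of_real y) = (x < y).
Proof. by rewrite /of_real; case: s => //=; exact: ltcR. Qed.

Lemma ge0_reK (z : K) : 0 <= z -> of_real (re z) = z.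
Proof.
rewrite /of_real /re; case: s z => //= z.
by rewrite lecE /= => /andP[/eqP z0 _]; rewrite [RHS]complexE z0; simpc.
Qed.

Lemma re_normK (E : normedModType K) (x : E) : of_real (re `|x|) = `|x|.
Proof. exact: ge0_reK. Qed.

Lemma re_norm_ge0 (E : normedModType K) (x : E) : 0 <= re `|x|.
Proof. by rewrite -ler_of_real re_normK of_real0. Qed.

End Scalars.

Section SupNorm.
Variables (R : realType) (s : scalars).
Local Notation K := (scalar_field R s).

(* The norm of a normedModType over K takes its values in K, so the supremum is
   taken in R, and sent back to K by of_real in the norms below. Since
   sup set0 = 0, this is also correct for D = set0. *)
Definition sup_norm (T : Type) (D : set T) (E : normedModType K) (f : T -> E) :
  R := sup [set re `|f t| | t in D].

Section Theory.
Variables (T : Type) (D : set T) (E : normedModType K).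
Implicit Types f g : T -> E.

Definition bounded_on f := exists M, forall t, D t -> re `|f t| <= M.

Lemma sup_norm_ub f t : bounded_on f -> D t -> re `|f t| <= sup_norm D f.
Proof.
move=> [M fM] Dt; apply: ub_le_sup; last by exists t.
by exists M => _ [u Du <-]; exact: fM.
Qed.

Lemma sup_norm_le f M : 0 <= M -> (forall t, D t -> re `|f t| <= M) ->
  sup_norm D f <= M.
Proof.
move=> M0 fM; have [->|/set0P[t Dt]] := eqVneq D set0.
  by rewrite /sup_norm image_set0 sup0.
by apply: ge_sup => [|_ [u Du <-]]; [exists (re `|f t|), t | exact: fM].
Qed.

Lemma sup_norm_ge0 f : bounded_on f -> 0 <= sup_norm D f.
Proof.
move=> bf; have [->|/set0P[t Dt]] := eqVneq D set0.
  by rewrite /sup_norm image_set0 sup0.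
exact: le_trans (re_norm_ge0 _) (sup_norm_ub bf Dt).
Qed.

Lemma sup_normD f g : bounded_on f -> bounded_on g ->
  sup_norm D (fun t => f t + g t) <= sup_norm D f + sup_norm D g.
Proof.
move=> bf bg; apply: sup_norm_le => [|t Dt].
  by rewrite addr_ge0 ?sup_norm_ge0.
apply: (@le_trans _ _ (re `|f t| + re `|g t|)).
  by rewrite -(ler_of_real s) of_realD !re_normK ler_normD.
by rewrite lerD ?sup_norm_ub.
Qed.

Lemma sup_normZ_le (l : K) f : bounded_on f ->
  sup_norm D (fun t => l *: f t) <= re `|l| * sup_norm D f.
Proof.
have l0 : 0 <= re `|l| by exact: (@re_norm_ge0 _ _ K^o).
move=> bf; apply: sup_norm_le => [|t Dt].
  by rewrite mulr_ge0 ?sup_norm_ge0.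
apply: (@le_trans _ _ (re `|l| * re `|f t|)); last first.
  by rewrite ler_wpM2l ?sup_norm_ub.
by rewrite -(ler_of_real s) of_realM !re_normK normrZ.
Qed.

Lemma bounded_onZ (l : K) f : bounded_on f -> bounded_on (fun t => l *: f t).
Proof.
move=> [M fM]; exists (re `|l| * M) => t /fM ftM.
rewrite -(ler_of_real s) of_realM !re_normK normrZ ler_wpM2l//.
by rewrite -re_normK ler_of_real.
Qed.

Lemma sup_normZ (l : K) f : bounded_on f ->
  of_real s (sup_norm D (fun t => l *: f t)) =
  `|l| * of_real s (sup_norm D f).
Proof.
move=> bf; have reM (g : R) : `|l| * of_real s g = of_real s (re `|l| * g).
  by rewrite of_realM ge0_reK.
apply/eqP; rewrite reM eq_le !ler_of_real sup_normZ_le//=.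
have [->|l0] := eqVneq l 0.
  rewrite normr0 -(ler_of_real s) of_realM ge0_reK// mul0r -(of_real0 R s).
  by rewrite ler_of_real; apply: sup_norm_ge0; exact: bounded_onZ.
have := sup_normZ_le l^-1 (bounded_onZ l bf).
rewrite -(ler_of_real s) of_realM ge0_reK// normfV ler_pdivlMl ?normr_gt0//.
rewrite -(ler_of_real s) of_realM ge0_reK//.
by under eq_fun do rewrite scalerA mulVf// scale1r.
Qed.

Lemma sup_norm0_eq0 f : bounded_on f -> of_real s (sup_norm D f) = 0 ->
  forall t, D t -> f t = 0.
Proof.
move=> bf; rewrite -(of_real0 R s) => /(can_inj (@of_realK R s)) f0 t Dt.
apply/normr0_eq0/eqP; rewrite eq_le normr_ge0 andbT -re_normK -(of_real0 R s).
by rewrite ler_of_real -f0; exact: sup_norm_ub.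
Qed.

End Theory.
End SupNorm.

Section BoundedFunctions.
Variables (R : realType) (s : scalars).
Local Notation K := (scalar_field R s).
Variables (S : Type) (E : normedModType K).

Definition bfun_pred : {pred S -> E} := [pred f | `[< bounded_fun f >]].

Record bfun := BFun { bfun_val :> S -> E ; bfunP : bfun_val \in bfun_pred }.

HB.instance Definition _ := [isSub for bfun_val].
HB.instance Definition _ := [Choice of bfun by <:].

Lemma bfun_predP (f : S -> E) : f \in bfun_pred <-> bounded_on setT f.
Proof.
split=> [/asboolP fb|[M fM]].
  have [M M0 fM] := pinfty_ex_gt0 fb; exists (re M) => t _.
  by rewrite -(ler_of_real s) re_normK (ge0_reK (ltW M0)); exact: fM.
apply/asboolT; exists (of_real s `|M|); split.
  by rewrite realE -(of_real0 R s) ler_of_real normr_ge0.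
move=> x /ltW Mx t _ /=; rewrite (le_trans _ Mx)// -re_normK ler_of_real.
by rewrite (le_trans (fM t _))// ler_norm.
Qed.

Lemma bfun_submod_closed : submod_closed bfun_pred.
Proof.
split=> [|l f g /bfun_predP/(bounded_onZ l)[M fM] /bfun_predP[N gN]].
  by apply/bfun_predP; exists 0 => t _; rewrite normr0 -(ler_of_real s)
    ge0_reK// of_real0.
apply/bfun_predP; exists (M + N) => t tT.
apply: le_trans (lerD (fM t tT) (gN t tT)).
by rewrite -(ler_of_real s) of_realD !re_normK; exact: ler_normD.
Qed.

HB.instance Definition _ :=
  GRing.isSubmodClosed.Build K (S -> E) bfun_pred bfun_submod_closed.
HB.instance Definition _ := [SubChoice_isSubLmodule of bfun by <:].

Definition bfun_norm (f : bfun) : K := of_real s (sup_norm setT f).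

Let bfunB (f : bfun) : bounded_on setT f.
Proof. by apply/bfun_predP; exact: bfunP. Qed.

Let bfun_normD f g : bfun_norm (f + g) <= bfun_norm f + bfun_norm g.
Proof. by rewrite -of_realD ler_of_real; exact: sup_normD. Qed.

Let bfun_normZ (l : K) f : bfun_norm (l *: f) = `|l| * bfun_norm f.
Proof. exact: sup_normZ. Qed.

Let bfun_norm0 f : bfun_norm f = 0 -> f = 0.
Proof. by move=> f0; apply/val_inj/funext => t; exact: (sup_norm0_eq0 _ f0). Qed.

HB.instance Definition _ :=
  Lmodule_isNormed.Build K bfun bfun_normD bfun_normZ bfun_norm0.

End BoundedFunctions.

Section Dual.
Variables (R : realType) (s : scalars).
Local Notation K := (scalar_field R s).
Variable E : normedModType K.

Definition dual_pred : {pred E -> K^o} :=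
  [pred f : E -> K^o | `[< linear f /\ continuous f >]].

Record dual := Dual { dual_val :> E -> K^o ; dualP : dual_val \in dual_pred }.

HB.instance Definition _ := [isSub for dual_val].
HB.instance Definition _ := [Choice of dual by <:].

Lemma dual_submod_closed : submod_closed dual_pred.
Proof.
split=> [|l f g].
  apply/asboolT; split=> [a x y|]; last exact: cst_continuous.
  by rewrite [RHS]addr0 [RHS]mulr0.
move=> /asboolP[lf cf] /asboolP[lg cg]; apply/asboolT; split=> [a x y|x].
  by rewrite !fctE lf lg /= !scalerDr !scalerA [l * a]mulrC addrACA.
by apply: cvgD; [apply: cvgZr; exact: cf|exact: cg].
Qed.

HB.instance Definition _ :=
  GRing.isSubmodClosed.Build K (E -> K^o) dual_pred dual_submod_closed.
HB.instance Definition _ := [SubChoice_isSubLmodule of dual by <:].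

Lemma dual_linear (f : dual) : linear f.
Proof. by have /asboolP[] := dualP f. Qed.

Lemma dual_continuous (f : dual) : continuous f.
Proof. by have /asboolP[] := dualP f. Qed.

HB.instance Definition _ (f : dual) :=
  GRing.isLinear.Build K E K^o _ (dual_val f) (dual_linear f).

Definition unit_ball : set E := [set x | `|x| <= 1].

Definition dual_norm (f : dual) : K := of_real s (sup_norm unit_ball f).

Let dualB (f : dual) : bounded_on unit_ball f.
Proof.
have /linear_boundedP bf :=
  continuous_linear_bounded 0 (dual_continuous (f := f) (x := 0)).
have [M M0 fM] := pinfty_ex_gt0 bf.
exists (re M) => x x1; rewrite -(ler_of_real s) re_normK (ge0_reK (ltW M0)).
by apply: le_trans (fM x) _; rewrite ler_piMr // ltW.
Qed.

Let dual_normD f g : dual_norm (f + g) <= dual_norm f + dual_norm g.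
Proof. by rewrite -of_realD ler_of_real; exact: sup_normD. Qed.

Let dual_normZ (l : K) f : dual_norm (l *: f) = `|l| * dual_norm f.
Proof. exact: sup_normZ. Qed.

Let dual_norm0 f : dual_norm f = 0 -> f = 0.
Proof.
move=> f0; apply/val_inj/funext => x /=; have [->|x0] := eqVneq x 0.
  exact: linear0.
have /= : f (`|x|^-1 *: x) = 0.
  by apply: (sup_norm0_eq0 _ f0) => //; rewrite /unit_ball/= normfZV.
rewrite linearZ /= => /eqP; rewrite scaler_eq0 invr_eq0 normr_eq0 (negPf x0).
by move/eqP.
Qed.

HB.instance Definition _ :=
  Lmodule_isNormed.Build K dual dual_normD dual_normZ dual_norm0.

End Dual.

Section NumericalRange.
Variables (R : realType) (s : scalars).
Local Notation K := (scalar_field R s).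

(* The vector u is not required to have norm 1: if X = 0, the inclusion below
   is the zero of the zero space of bounded functions, with no states. *)
Definition state_set (E : normedModType K) (u : E) : set (dual E) :=
  [set phi : dual E | `|phi| = 1 /\ phi u = 1].

(* Convex combinations in [convex_set] have their coefficients in the real
   interval [0, 1], also when K is the complex field. *)
Definition closed_convex_hull (A : set K^o) : set K^o :=
  smallest [set C : set K^o | closed C /\ convex_set C] A.

Variables (Y : normedModType K) (X : set Y).

Definition unit_sphere : set Y := [set x | X x /\ `|x| = 1].

Definition Pi_set : set (unit_sphere * dual Y) :=
  [set p | state_set (\val p.1) p.2].

Definition BPB_pair := forall eps : R, 0 < eps -> exists2 delta : R, 0 < delta &
  forall (x0 : unit_sphere) (phi0 : dual Y), `|phi0| = 1 ->
    1 - delta < re (phi0 (\val x0)) ->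
    exists (x : unit_sphere) (phi : dual Y), [/\ Pi_set (x, phi),
      `|\val x0 - \val x| < of_real s eps & `|phi0 - phi| < of_real s eps].

Definition spatial_range (f : unit_sphere -> Y) : set K^o :=
  [set p.2 (f p.1) | p in Pi_set].

Lemma inclusion_bounded :
  (\val : unit_sphere -> Y) \in @bfun_pred R s unit_sphere Y.
Proof.
apply/bfun_predP; exists 1 => x _.
by have /set_mem[_ x1] := valP x; rewrite -(ler_of_real s) re_normK x1 /of_real;
  case: (s).
Qed.

Definition sphere_inclusion : bfun unit_sphere Y := BFun inclusion_bounded.

Definition intrinsic_range (f : bfun unit_sphere Y) : set K^o :=
  [set Phi f | Phi in state_set sphere_inclusion].

End NumericalRange.

(* Main.v *)
Require Import Defs.
From HB Require Import structures.
From mathcomp Require Import all_boot all_order all_algebra complex ring lra.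
From mathcomp Require Import all_classical all_reals interval_inference.
From mathcomp Require Import topology normedtype convex.

(** The inclusion of the spatial range in the intrinsic one is evaluation: a
    pair (x, y* ) of Pi gives the state g |-> y* (g x), and the intrinsic range
    is closed and convex. Both facts are read off a description without
    functionals: for |u| <= 1 a scalar l is a value at v of a state at u if and
    only if |a + b l| <= |a u + b v| for all scalars a and b ([stateP]). One
    direction is the definition of the dual norm. For the other, a u + b v |->
    a + b l is a well-defined contraction on the span of u and v, and the
    Hahn-Banach theorem extends it. The condition on l is visibly closed and
    convex.

    For the converse let Phi be a state and t > 0 small. As Phi is a state at
    the inclusion J, 1 + t Re Phi(f) <= |J + t f|. Choose x0 in the sphere
    where |x0 + t f(x0)| is within t^2 of that supremum, and a norm-one
    functional y0* attaining its norm at that vector. Since Re y0* (x0) <= 1,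
    dividing by t gives Re Phi(f) <= Re y0* (f(x0)) + t; and y0* (x0) is close
    to 1, because the term of f contributes only O(t). The
    Bishop-Phelps-Bollobas property moves (x0, y0* ) to a nearby pair of Pi,
    and uniform continuity of f makes the change in y0* (f(x0)) small. Hence Re
    Phi(f) is at most Re w + e for some w in W(f) ([spatial_support]). Applied
    to the multiples m f this says that no closed half-plane containing W(f)
    misses Phi(f), and a nearest-point argument in the scalar field puts Phi(f)
    in the closed convex hull ([mem_closed_convex_hull]).

    Norms take their values in the scalar field, so estimates are made on the
    real number re `|x|. *)

Set Implicit Arguments.
Unset Strict Implicit.
Unset Printing Implicit Defensive.

Import Order.TTheory GRing.Theory Num.Theory.
Import numFieldNormedType.Exports.

Local Open Scope classical_set_scope.
Local Open Scope ring_scope.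

(** * The Hahn-Banach theorem over the reals *)

Section HahnBanach.
Variables (R : realType) (V : lmodType R) (p : V -> R).
Hypothesis pD : forall x y, p (x + y) <= p x + p y.
Hypothesis pZ : forall t x, 0 <= t -> p (t *: x) = t * p x.

(** Partial linear functionals below p, encoded by their graphs: a subspace of
    V * R lying under p is automatically single-valued when p is sublinear, and
    unions of chains of such subspaces need no gluing of functions. *)
Definition dominated_graph (G : set (V * R^o)) :=
  [/\ G 0, forall t z w, G z -> G w -> G (t *: z + w)
    & forall z, G z -> z.2 <= p z.1].

Lemma maximal_dominated_graph G : dominated_graph G ->
  exists M, [/\ dominated_graph M, G `<=` M
    & forall H, dominated_graph H -> M `<=` H -> H `<=` M].
Proof.
move=> [G0 GZD Gp].
(* Zorn's lemma also ranges over the empty chain, whose union is empty; adding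
   G inside the predicate keeps 0 in the graph. *)
pose P (A : set (V * R^o)) := dominated_graph (A `|` G).
have [|A [PA maxA]] := @Zorn_bigcup _ P.
  move=> F FP Ftot; split=> [|t z w|z]; first by right.
    have AG A z' w' : F A -> (A `|` G) z' -> (A `|` G) w' ->
        (\bigcup_(A in F) A `|` G) (t *: z' + w').
      move=> FA Az Aw; have [_ AZD _] := FP _ FA.
      by have [?|?] := AZD t _ _ Az Aw; [left; exists A|right].
    move=> [[A FA Az]|Gz] [[B FB Bw]|Gw].
    - have [AB|BA] := Ftot _ _ FA FB.
        by apply: (AG B) => //; left; [exact: AB|].
      by apply: (AG A) => //; left; [|exact: BA].
    - by apply: (AG A) => //; [left|right].
    - by apply: (AG B) => //; [right|left].
    - by right; exact: GZD.
  move=> [[A FA Az]|Gz]; last exact: Gp.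
  by have [_ _ +] := FP _ FA; apply; left.
exists (A `|` G); split=> // H domH AGH.
have HG : H `|` G = H.
  by apply/setUidPl => z Gz; apply: AGH; right.
apply: contrapT => nHA; apply: (maxA H); last by rewrite /P HG.
rewrite properEneq; split=> [|z Az]; last by apply: AGH; left.
by apply/eqP => AH; apply: nHA; rewrite AH => z ?; left.
Qed.

(** One-dimensional extension: a value c at x0 keeps the graph under p as soon
    as it lies between r - p (y - x0) and p (y + x0) - r for all (y, r) in the
    graph, and subadditivity of p leaves room for such a c. By maximality (x0,
    c) is already in the graph. *)
Lemma maximal_dominated_graph_total M : dominated_graph M ->
  (forall H, dominated_graph H -> M `<=` H -> H `<=` M) ->
  forall x, exists c, M (x, c).
Proof.
move=> [M0 MZD Mp] maxM x0.
have MZ t z : M z -> M (t *: z).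
  by move=> Mz; rewrite -[_ *: _]addr0; exact: MZD.
pose L := [set z.2 - p (z.1 - x0) | z in M].
have cLU z w : M z -> M w -> z.2 - p (z.1 - x0) <= p (w.1 + x0) - w.2.
  move=> Mz Mw; have := Mp _ (MZD 1 _ _ Mz Mw); rewrite !scale1r /= => zw.
  have := pD (z.1 - x0) (w.1 + x0); rewrite addrACA addNr addr0.
  by move: zw => /=; lra.
have L0 : L !=set0 by exists (0 - p (0 - x0)); exists 0.
pose c := sup L.
have cL z : M z -> z.2 - p (z.1 - x0) <= c.
  move=> Mz; apply: ub_le_sup; last by exists z.
  by exists (p (0 + x0) - 0) => _ [w Mw <-]; exact: (cLU _ 0).
have cU z : M z -> c <= p (z.1 + x0) - z.2.
  by move=> Mz; apply: ge_sup => // _ [w Mw <-]; exact: cLU.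
pose H := [set z | exists t : R, M (z - t *: ((x0, c) : V * R^o))].
have HM : M `<=` H by move=> z Mz; exists 0; rewrite scale0r subr0.
exists c; apply: (maxM H) => //; last by exists 1; rewrite scale1r subrr.
split=> [|t z w [a Mz] [b Mw]|z [t]]; first exact: HM.
  exists (t * a + b).
  have -> : t *: z + w - (t * a + b) *: (x0, c) =
      t *: (z - a *: ((x0, c) : V * R^o)) + (w - b *: ((x0, c) : V * R^o)).
    by rewrite scalerDl scalerBr scalerA opprD addrACA.
  exact: MZD.
set y := z - _ => My.
have -> : z = y + t *: ((x0, c) : V * R^o) by rewrite subrK.
have scE (a b : R) : a *: (b : R^o) = a * b by [].
case: y My => y r My /=; rewrite scE.
have [->|t0] := eqVneq t 0.
  by rewrite scale0r mul0r !addr0; exact: (Mp _ My).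
(* By homogeneity, only the multiples 1 and -1 of x0 matter. *)
case: (ltgtP t 0) t0 => // t0 _; last first.
  have := cU _ (MZ t^-1 _ My).
  rewrite /= -(ler_pM2l t0) mulrBr -(pZ _ (ltW t0)).
  rewrite scalerDr scalerA mulrA mulfV ?gt_eqF// scale1r mul1r.
  by rewrite lerBrDl.
have s0 : 0 < - t by rewrite oppr_gt0.
have := cL _ (MZ (- t)^-1 _ My).
rewrite /= -(ler_pM2l s0) mulrBr -(pZ _ (ltW s0)).
rewrite scalerBr scalerA mulrA mulfV ?gt_eqF// scale1r mul1r.
by rewrite scaleNr opprK mulNr; lra.
Qed.

Theorem hahn_banach G : dominated_graph G ->
  exists g : {linear V -> R^o}, (forall x, g x <= p x) /\
    forall z, G z -> g z.1 = z.2.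
Proof.
move=> /maximal_dominated_graph[M [[M0 MZD Mp] GM maxM]].
have /choice[g Mg] := maximal_dominated_graph_total (And3 M0 MZD Mp) maxM.
have p0 : p 0 = 0 by rewrite -(scale0r 0) pZ// mul0r.
have le0 x a b : M (x, a) -> M (x, b) -> a <= b.
  move=> Ma Mb; have := Mp _ (MZD (-1) _ _ Mb Ma).
  by rewrite scaleN1r /= addNr p0 addrC subr_le0.
have uniq x a : M (x, a) -> g x = a.
  by move=> Mx; apply/eqP; rewrite eq_le !(le0 x).
have glin : linear (g : V -> R^o).
  by move=> t x y; apply: uniq; exact: (MZD t _ _ (Mg x) (Mg y)).
pose gL := GRing.isLinear.Build R V R^o *:%R g glin.
pose gl : {linear V -> R^o} := HB.pack g gL.
exists gl; split=> [x|[x a] /GM Mxa]; first exact: (Mp _ (Mg x)).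
exact: uniq.
Qed.

End HahnBanach.

(** * The scalar field and its real structure *)

Section ScalarField.
Variables (R : realType) (s : scalars).
Local Notation K := (scalar_field R s).
Implicit Types (a b : K) (t : R).

Lemma of_real1 : of_real s 1 = 1 :> scalar_field R s.
Proof. by rewrite /of_real; case: s. Qed.

(** The imaginary part of a is -re ('i * a), so real parts of multiples
    determine a. *)
Lemma re_eqP a b : (forall c, re (c * a) = re (c * b)) -> a = b.
Proof.
rewrite /re; case: s a b => //= [a b|a b ab].
  by move=> /(_ 1); rewrite !mul1r.
have := ab 1; have := ab 'i; rewrite !mul1r.
case: a b {ab} => a1 a2 [b1 b2]; rewrite /= !mul0r !mul1r !sub0r.
by move=> /oppr_inj -> ->.
Qed.

Lemma reD a b : re (a + b) = re a + re b.
Proof. by rewrite /re; case: s a b => //= a b; exact: raddfD. Qed.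

Lemma reN a : re (- a) = - re a.
Proof. by rewrite /re; case: s a => //= a; exact: raddfN. Qed.

Lemma reZ t a : re (of_real s t * a) = t * re a.
Proof.
rewrite /re /of_real; case: s a => //= -[x y] /=.
by rewrite mul0r subr0.
Qed.

Lemma re_abs_ge0 a : 0 <= re `|a|.
Proof. exact: (@re_norm_ge0 R s (scalar_field R s)^o). Qed.

Lemma re_absD a b : re `|a + b| <= re `|a| + re `|b|.
Proof. by rewrite -(ler_of_real s) of_realD !ge0_reK// ler_normD. Qed.

Lemma re_le_norm a : re a <= re `|a|.
Proof.
rewrite /re; case: s a => //= [a|a]; first exact: ler_norm.
apply: le_trans (ler_norm _) _; rewrite -lecR.
exact: (normc_ge_Re a).
Qed.

Lemma norm_of_real t : 0 <= t -> re `|of_real s t| = t.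
Proof.
by move=> t0; rewrite ger0_norm ?of_realK// -(of_real0 R s) ler_of_real.
Qed.

Lemma phase a : exists2 u : K, `|u| = 1 & re (u * a) = re `|a|.
Proof.
have [->|a0] := eqVneq a 0; first by exists 1; rewrite ?normr1// mul1r normr0.
exists (`|a| / a); first by rewrite normrM normfV normr_id divff// normr_eq0.
by rewrite divfK.
Qed.

(** The law of cosines, with c the conjugate of a; it lets the
    nearest-point argument below treat both scalar fields at once. *)
Lemma sqr_distE a : exists c : K, forall b t,
  re `|a - of_real s t * b| ^+ 2 =
    re `|a| ^+ 2 - t * re (c * b) *+ 2 + t ^+ 2 * re `|b| ^+ 2.
Proof.
rewrite /re /of_real; case: s a => /= [a|[x y]].
  by exists a => b t; rewrite !real_normK ?num_real//; ring.
exists (x -i* y)%C => -[u v] t.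
rewrite /= !sqr_sqrtr ?addr_ge0 ?sqr_ge0//; ring.
Qed.

(** An alias, because a real and a complex scaling cannot both be canonical on
    E. *)
Definition restrict_scalars (E : lmodType K) : Type := E.

Section RestrictScalars.
Variable E : lmodType K.
Local Notation E' := (restrict_scalars E).
HB.instance Definition _ := GRing.Zmodule.on E'.

Let rscale t (x : E') : E' := of_real s t *: (x : E).

Fact rscaleA t u x : rscale t (rscale u x) = rscale (t * u) x.
Proof. by rewrite /rscale scalerA of_realM. Qed.

Fact rscale1 : left_id 1 rscale.
Proof. by move=> x; rewrite /rscale of_real1 scale1r. Qed.

Fact rscaleDr : right_distributive rscale +%R.
Proof. by move=> t x y; exact: scalerDr. Qed.

Fact rscaleDl x : {morph rscale^~ x : t u / t + u}.
Proof. by move=> t u; rewrite /rscale of_realD scalerDl. Qed.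

HB.instance Definition _ :=
  GRing.Zmodule_isLmodule.Build R E' rscaleA rscale1 rscaleDr rscaleDl.

End RestrictScalars.

Lemma restrict_scalarsE (E : lmodType K) t (x : restrict_scalars E) :
  t *: x = of_real s t *: (x : E).
Proof. by []. Qed.

Section Norm.
Variable E : normedModType K.
Implicit Types x y : E.

Lemma re_normD x y : re `|x + y| <= re `|x| + re `|y|.
Proof. by rewrite -(ler_of_real s) of_realD !re_normK ler_normD. Qed.

Lemma re_normZ a x : re `|a *: x| = re `|a| * re `|x|.
Proof.
apply: (can_inj (@of_realK R s)).
by rewrite of_realM !ge0_reK// normrZ.
Qed.

Lemma norm_eq1P x : `|x| = 1 <-> re `|x| = 1.
Proof.
split=> [->|]; first by rewrite -of_real1 of_realK.
by move=> x1; rewrite -re_normK x1 of_real1.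
Qed.

End Norm.

(** In the complex case the functional is x |-> g x - 'i * g ('i *: x), the
    only candidate since re ('i * phi x) must be g ('i *: x). *)
Lemma complexify (E : lmodType K) (g : E -> R)
    (gD : forall x y, g (x + y) = g x + g y)
    (gZ : forall t x, g (of_real s t *: x) = t * g x) :
  exists2 phi : E -> K^o, linear phi & forall x, re (phi x) = g x.
Proof.
rewrite /of_real /re in gZ *; case: s E g gD gZ => /= E g gD gZ.
  by exists g => // a x y /=; rewrite gD gZ.
exists (fun x => (g x -i* g ('i *: x))%C) => // -[p q] x y.
have gC u v z : g ((u +i* v)%C *: z) = u * g z + v * g ('i *: z).
  by rewrite -2!gZ -gD scalerA -scalerDl; congr (g (_ *: _)); simpc.
rewrite [(_ +i* _)%C *: _ in RHS]/( _ * _) scalerDr !gD scalerA; simpc.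
rewrite (gC p q) (gC (- q) p); congr (_ +i* _)%C; ring.
Qed.

End ScalarField.

(** * Contractive functionals and values of states *)

Section Dual.
Variables (R : realType) (s : scalars).
Local Notation K := (scalar_field R s).
Variable E : normedModType K.

Lemma contractive_dual (phi : E -> K^o) : linear phi ->
  (forall x, `|phi x| <= `|x|) -> phi \in @dual_pred R s E.
Proof.
move=> lphi phi1; apply/asboolT; split=> //.
pose gL := GRing.isLinear.Build K E K^o *:%R phi lphi.
pose gl : {linear E -> K^o} := HB.pack phi gL.
apply/(@linear_bounded_continuous _ _ _ gl)/linear_boundedP.
exists 1; split=> [|r r1 x]; first exact: real1.
by apply: le_trans (phi1 x) _; rewrite ler_peMl// ltW.
Qed.

(** The real Hahn-Banach theorem applied to real parts. Domination of re is
    enough: a rotation by a phase of phi x bounds |phi x|, and the submodule G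
    is stable under all scalars, so agreement of real parts on G is agreement.
    *)
Lemma dual_extension (G : set (E * K^o)) : G 0 ->
  (forall a z w, G z -> G w -> G (a *: z + w)) ->
  (forall z, G z -> re z.2 <= re `|z.1|) ->
  exists phi : dual E, (forall x, `|phi x| <= `|x|) /\
    forall z, G z -> phi z.1 = z.2.
Proof.
move=> G0 GZD Gp.
have GZ a z : G z -> G (a *: z).
  by move=> Gz; rewrite -[_ *: _]addr0; exact: GZD.
pose G' := [set (z.1 : restrict_scalars E, re z.2) | z in G].
have [|||g [gp gG]] :=
  @hahn_banach R (restrict_scalars E) (fun x : E => re `|x|) _ _ G'.
- exact: re_normD.
- move=> t x t0; rewrite restrict_scalarsE re_normZ norm_of_real//.
- split=> [|t _ _ [z Gz <-] [w Gw <-]|_ [z Gz <-]].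
  + by exists 0 => //; rewrite -[RHS]/(0, 0) /= -(of_real0 R s) of_realK.
  + exists (of_real s t *: z + w); first exact: GZD.
    by rewrite /= reD reZ.
  + exact: Gp.
have [||phi lphi rephi] := @complexify R s E g.
- by move=> x y; exact: (raddfD g).
- by move=> t x; rewrite -restrict_scalarsE linearZ.
have phiZ := GRing.scalable_linear lphi.
have phi1 x : `|phi x| <= `|x|.
  have [u u1 uphi] := phase (phi x).
  rewrite -re_normK -[leRHS]re_normK ler_of_real -uphi.
  rewrite -[u * _]/(u *: _) -phiZ rephi; apply: le_trans (gp _) _.
  by rewrite re_normZ u1 -(of_real1 R s) of_realK mul1r.
exists (Dual (contractive_dual lphi phi1)); split=> // z Gz /=.
apply: re_eqP => c; rewrite -[c * _]/(c *: _) -phiZ rephi.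
by apply: (gG (_, _)); exists (c *: z) => //; exact: GZ.
Qed.

Lemma dual_bounded (phi : dual E) : bounded_on (@unit_ball R s E) phi.
Proof.
have /linear_boundedP bphi :=
  continuous_linear_bounded 0 (dual_continuous (f := phi) (x := 0)).
have [M M0 phiM] := pinfty_ex_gt0 bphi.
exists (re M) => x x1; rewrite -(ler_of_real s) re_normK (ge0_reK (ltW M0)).
by apply: le_trans (phiM x) _; rewrite ler_piMr // ltW.
Qed.

Lemma dual_normE (phi : dual E) :
  `|phi| = of_real s (sup_norm (@unit_ball R s E) phi).
Proof. by []. Qed.

Lemma dual_le_norm (phi : dual E) x : re `|phi x| <= re `|phi| * re `|x|.
Proof.
have [->|x0] := eqVneq x 0.
  by rewrite linear0 !normr0 -(of_real0 R s) of_realK mulr0.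
have : re `|phi (`|x|^-1 *: x)| <= re `|phi|.
  rewrite dual_normE of_realK; apply: sup_norm_ub; first exact: dual_bounded.
  by rewrite /unit_ball/= normfZV.
rewrite linearZ re_normZ => /(ler_wpM2r (re_norm_ge0 x)).
by rewrite mulrAC -re_normZ normfZV// -(of_real1 R s) of_realK mul1r.
Qed.

Lemma dual_norm_le1 (phi : dual E) :
  (forall x, `|phi x| <= `|x|) -> re `|phi| <= 1.
Proof.
move=> phi1; rewrite dual_normE of_realK; apply: sup_norm_le => // x x1.
by rewrite -(ler_of_real s) re_normK of_real1; exact: le_trans (phi1 x) x1.
Qed.

Lemma dual_norm1_le (phi : dual E) x : `|phi| = 1 -> re `|phi x| <= re `|x|.
Proof. by move=> /norm_eq1P phi1; rewrite -[leRHS]mul1r -phi1 dual_le_norm. Qed.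

(** The inequalities say that a *: u + b *: v |-> a + b * l is well defined and
    contractive on the span of u and v. With b = 0 they force re `|u| = 1,
    hence a state of norm exactly 1. *)
Lemma stateP (u v : E) (l : K) : re `|u| <= 1 ->
  (exists2 phi, state_set u phi & phi v = l) <->
  (forall a b, re `|a + b * l| <= re `|a *: u + b *: v|).
Proof.
move=> u1; split=> [[phi [phi1 phiu] phiv] a b|uvl].
  have <- : phi (a *: u + b *: v) = a + b * l.
    by rewrite linearP linearZ /= phiu phiv [a *: _]mulr1.
  exact: dual_norm1_le.
pose G := [set (ab.1 *: u + ab.2 *: v, ab.1 + ab.2 * l) | ab in @setT (K * K)].
have [|||phi [phi1 phiG]] := @dual_extension G.
- by exists (0, 0) => //=; rewrite !scale0r mul0r !addr0.
- move=> a _ _ [[b c] _ <-] [[b' c'] _ <-].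
  exists (a * b + b', a * c + c') => //=; congr (_, _).
    transitivity (a *: (b *: u + c *: v) + (b' *: u + c' *: v)) => //.
    by rewrite scalerDr !scalerA !scalerDl addrACA.
  transitivity (a * (b + c * l) + (b' + c' * l)) => //; ring.
- by move=> _ [[a b] _ <-] /=; apply: le_trans (uvl a b); exact: re_le_norm.
have phiu : phi u = 1.
  by apply: (phiG (_, _)); exists (1, 0) => //=;
    rewrite scale1r scale0r mul0r !addr0.
exists phi; last first.
  by apply: (phiG (_, _)); exists (0, 1) => //=;
    rewrite scale1r scale0r mul1r !add0r.
split=> //; apply/norm_eq1P; apply/eqP; rewrite eq_le dual_norm_le1//=.
have := dual_le_norm phi u; rewrite phiu normr1 -{1}(of_real1 R s) of_realK.
move=> /le_trans; apply; rewrite ler_piMr// re_norm_ge0//.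
Qed.

End Dual.

(** * Closedness and convexity; membership in a closed convex hull *)

Section Scalars.
Variables (R : realType) (s : scalars).
Local Notation K := (scalar_field R s).

Lemma state_values_convex (E : normedModType K) (u v : E) : re `|u| <= 1 ->
  convex_set ([set phi v | phi in state_set u] : set K^o).
Proof.
move=> u1 l m t; rewrite !inE => lV mV; apply/(stateP _ _ u1) => a b.
have {}lV := (stateP _ _ u1).1 lV a b; have {}mV := (stateP _ _ u1).1 mV a b.
set q := t%:num; have q0 : 0 <= q by exact: (ge0 t).
have q1 : 0 <= 1 - q by rewrite subr_ge0; exact: (le1 t).
have -> : a + b * conv t l m =
    q *: (a + b * l : K^o) + (1 - q) *: (a + b * m : K^o).
  transitivity (a + b * (q * l + (1 - q) * m)) => //.
  rewrite -[_ *: _]/(q * (a + b * l)) -[_ *: _]/((1 - q) * (a + b * m)).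
  ring.
apply: le_trans (re_normD _ _) _; rewrite !re_normZ.
set N := re `|a *: u + b *: v|.
have -> : N = re `|q| * N + re `|1 - q| * N.
  by rewrite -mulrDl -reD !ger0_norm// addrC subrK
    -(of_real1 R s) of_realK mul1r.
by apply: lerD; apply: ler_wpM2l => //; exact: re_abs_ge0.
Qed.

Lemma state_values_closed (E : normedModType K) (u v : E) : re `|u| <= 1 ->
  closed ([set phi v | phi in state_set u] : set K^o).
Proof.
move=> u1 l cl; apply/(stateP _ _ u1) => a b; apply/ler_addgt0Pr => e e0.
pose d := e / (1 + re `|b|).
have b0 : 0 < 1 + re `|b| by rewrite ltr_pwDl//; exact: re_abs_ge0.
have d0 : 0 < of_real s d by rewrite -(of_real0 R s) ltr_of_real divr_gt0.
have [m [mV lm]] := cl _ (nbhsx_ballx (l : K^o) _ d0).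
have {}lm : re `|l - m| <= d.
  move: lm; rewrite -ball_normE/= => lm.
  by rewrite -(ler_of_real s) ge0_reK// ltW.
have {}mV := (stateP _ _ u1).1 mV a b.
have -> : a + b * l = (a + b * m : K^o) + b *: (l - m : K^o).
  by transitivity ((a + b * m) + b * (l - m) : K) => //; ring.
apply: le_trans (re_normD _ _) (lerD mV _); rewrite re_normZ.
apply: (@le_trans _ _ (re `|b| * d)).
  by apply: ler_wpM2l => //; exact: re_abs_ge0.
by rewrite /d mulrCA ger_pMr// ler_pdivrMr// mul1r lerDr.
Qed.

(** If A is bounded and for no m does the real functional z |-> re (m * z)
    separate l strictly from A, then l is in the hull. Take c in a closed
    convex C containing A, almost nearest to l, and test with m the conjugate
    of l - c: some w in A lies almost as far as l in the direction l - c, and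
    moving from c towards w comes strictly closer to l than the infimum of the
    distances, unless that infimum is 0. *)
Lemma mem_closed_convex_hull (A : set K^o) (M : R) (l : K) :
  (forall w, A w -> re `|w| <= M) ->
  (forall (m : K) (e : R), 0 < e ->
    exists2 w, A w & re (m * l) <= re (m * w) + e) ->
  closed_convex_hull A l.
Proof.
move=> AM supp C [[clC cvxC] AC]; apply: contrapT => nCl.
have [r r0 rC] : exists2 r : R, 0 < r & forall c, C c -> r <= re `|l - c|.
  have : nbhs (l : K^o) (~` C).
    by apply: open_nbhs_nbhs; split=> //; exact: closed_openC.
  move=> /nbhs_ballP[r /= r0 rC]; exists (re r).
    by rewrite -(ltr_of_real s) ge0_reK ?of_real0// ltW.
  move=> c Cc; rewrite leNgt; apply/negP => lc; apply: (rC c) => //.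
  by rewrite -ball_normE/= -(@re_normK _ _ K^o) -(ge0_reK (ltW r0)) ltr_of_real.
pose D := [set re `|l - c| ^+ 2 | c in C].
have [w0 /AC Cw0 _] := supp 0 1 ltr01.
have D0 : D !=set0 by exists (re `|l - w0| ^+ 2), w0.
have Dlb : lbound D (r ^+ 2).
  by move=> _ [c Cc <-]; rewrite ler_sqr ?nnegrE ?re_norm_ge0 ?rC// ltW.
pose q := inf D.
have q0 : 0 < q by rewrite (lt_le_trans _ (lb_le_inf D0 Dlb))// exprn_gt0.
have qD c : C c -> q <= re `|l - c| ^+ 2.
  by move=> Cc; apply: ge_inf; [exists (r ^+ 2)|exists c].
have M0 : 0 <= M.
  by have [w /AM + _] := supp 0 1 ltr01; apply: le_trans; exact: re_abs_ge0.
pose B := M + re `|l| + q + 1.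
have l0 : 0 <= re `|l| by exact: re_abs_ge0.
have B0 : 1 <= B by rewrite /B; lra.
(* B bounds the length of the segment from c to w. At t, the cross term gains
   about 2 * t * q on the squared distance; the quadratic term, the slack
   t * q / 2 for c and the slack q / 4 for w each cost at most t * q / 2. *)
pose t := q / (2 * B ^+ 2).
have qB : q <= B by rewrite /B; lra.
have BB : B <= B ^+ 2 by rewrite expr2 ler_pMr// (lt_le_trans ltr01).
have tB : t * B ^+ 2 = q / 2.
  by rewrite /t; field; rewrite gt_eqF// (lt_le_trans ltr01).
have t0 : 0 < t.
  by rewrite divr_gt0// mulr_gt0// exprn_gt0// (lt_le_trans ltr01).
have t1 : t <= 1 / 2 by nra.
have tq : t * q <= 1 by nra.
have eta0 : 0 < t * q / 2 by rewrite divr_gt0// mulr_gt0.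
have [_ [c Cc <-]] := inf_adherent eta0 (conj D0 (ex_intro _ _ Dlb)).
rewrite -/q => cq.
pose N := re `|l - c| ^+ 2.
have [m mE] := sqr_distE (l - c).
(* The instance t = 1, b = l - c of the identity. *)
have mN : re (m * (l - c)) = N.
  have := mE (l - c) 1; rewrite of_real1 mul1r subrr normr0 -(of_real0 R s).
  by rewrite of_realK -/N; lra.
have e0 : 0 < q / 4 by rewrite divr_gt0.
have [w Aw lw] := supp m _ e0.
have wcm : N - q / 4 <= re (m * (w - c)).
  have -> : m * (w - c) = m * (l - c) + (m * w - m * l) by ring.
  by move: lw; rewrite !reD reN mN; lra.
have a0 : 0 <= re `|l - c| by exact: re_abs_ge0.
have wcB : re `|w - c| <= B.
  have -> : w - c = w + (l - c) - l by ring.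
  have aq : re `|l - c| <= q + 1 by nra.
  apply: le_trans (re_absD _ _) _; rewrite normrN.
  apply: le_trans (lerD (re_absD _ _) (lexx _)) _.
  by have := AM w Aw; rewrite /B; lra.
have t01 : 0 <= of_real s t by rewrite -(of_real0 R s) ler_of_real ltW.
have t11 : of_real s t <= 1 by rewrite -(of_real1 R s) ler_of_real; lra.
have /set_mem Cv := cvxC w c (Itv01 t01 t11) (mem_set (AC w Aw)) (mem_set Cc).
have := qD _ Cv.
have -> : l - conv (Itv01 t01 t11) (w : convex_lmodType K^o) c =
    l - c - of_real s t * (w - c).
  transitivity (l - (of_real s t * w + (1 - of_real s t) * c)) => //; ring.
rewrite mE -/N => qle.
have b0 : 0 <= re `|w - c| by exact: re_abs_ge0.
have tb : t ^+ 2 * re `|w - c| ^+ 2 <= t * (q / 2).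
  by rewrite -tB mulrA -expr2 ler_wpM2l ?sqr_ge0// ler_sqr// nnegrE; lra.
have qN : q <= N by exact: qD.
have : t * (N - q / 4) <= t * re (m * (w - c)) by rewrite ler_wpM2l// ltW.
rewrite -/N in cq.
have : t * q <= t * N by rewrite ler_wpM2l// ltW.
nra.
Qed.

End Scalars.

(** * The spatial and the intrinsic numerical range *)

Section NumericalRanges.
Variables (R : realType) (s : scalars).
Local Notation K := (scalar_field R s).
Variables (Y : normedModType K) (X : set Y).
Local Notation S := (unit_sphere X).

Lemma bfun_bounded (g : bfun S Y) : bounded_on setT g.
Proof. by apply/bfun_predP; exact: bfunP. Qed.

Lemma bfun_ub (g : bfun S Y) x : re `|g x| <= re `|g|.
Proof.
rewrite [`|g|]/(of_real s _) of_realK; apply: sup_norm_ub => //.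
exact: bfun_bounded.
Qed.

Lemma norm_sphere (x : S) : `|\val x| = 1 :> K.
Proof. by have /set_mem[] := valP x. Qed.

Lemma norm_sphere_inclusion : re `|sphere_inclusion X| <= 1.
Proof.
rewrite [`|_|]/(of_real s _) of_realK; apply: sup_norm_le => // x _.
by rewrite norm_sphere -(of_real1 R s) of_realK.
Qed.

(** A norm-one functional attaining its norm at y is a state at the unit vector
    of y. *)
Lemma norming (y : Y) : y != 0 ->
  exists2 phi : dual Y, `|phi| = 1 & phi y = `|y|.
Proof.
move=> y0; have u1 : re `| `|y|^-1 *: y| <= 1.
  by rewrite normfZV// -(of_real1 R s) of_realK.
have [|phi [phi1 phiy] _] := (stateP 0 0 u1).2.
  move=> a b; rewrite mulr0 scaler0 !addr0 re_normZ normfZV//.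
  by rewrite -(of_real1 R s) of_realK mulr1.
exists phi => //; move: phiy; rewrite linearZ /= -[_ *: _]/(_ * _).
by move/(canRL (mulVKf _)); rewrite mulr1; apply; rewrite normr_eq0.
Qed.

Lemma spatial_sub_intrinsic (f : bfun S Y) :
  spatial_range f `<=` intrinsic_range f.
Proof.
move=> _ [[x phi] [phi1 phix] <-].
apply/(stateP _ _ norm_sphere_inclusion) => a b.
have <- : phi (a *: \val x + b *: f x) = a + b * phi (f x).
  by rewrite linearP linearZ /= phix [a *: _]mulr1.
apply: le_trans (dual_norm1_le _ phi1) _.
exact: (bfun_ub (a *: sphere_inclusion X + b *: f) x).
Qed.

(** The heart of the matter: for small t, a functional norming x0 + t f(x0),
    where this vector is almost as long as J + t f, is almost 1 at x0 and
    almost as large as Phi at f. The Bishop-Phelps-Bollobas property then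
    replaces it by an exact state. *)
Lemma spatial_support (f : bfun S Y) (Phi : dual (bfun S Y)) (e : R) :
  BPB_pair X ->
  (forall e : R, 0 < e -> exists2 d : R, 0 < d & forall x y : S,
     `|\val x - \val y| < of_real s d -> re `|f x - f y| <= e) ->
  state_set (sphere_inclusion X) Phi -> 0 < e ->
  exists2 w, spatial_range f w & re (Phi f) <= re w + e.
Proof.
move=> bpb fuc [Phi1 PhiJ] e0.
pose M := re `|f|; have M0 : 0 <= M by exact: re_norm_ge0.
have [d1 d10 fd1] := fuc (e / 4) (divr_gt0 e0 (ltr0n _ 4)).
pose e1 := Num.min d1 (e / (4 * (M + 1))).
have M1 : 0 < M + 1 by lra.
have e10 : 0 < e1 by rewrite lt_min d10 divr_gt0// mulr_gt0.
have e1M : e1 * M <= e / 4.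
  apply: (@le_trans _ _ (e / (4 * (M + 1)) * (M + 1))).
    apply: ler_pM => //; [exact: ltW|by rewrite ge_min lexx orbT|lra].
  by rewrite invfM mulrA divfK// gt_eqF.
have [delta delta0 bpbd] := bpb _ e10.
(* Both re (phi0 x0) > 1 - delta and N > t * t follow from t * (2 * M + 2)
   being small. *)
pose t := Num.min (e / 4) (Num.min 1 (delta / 2) / (2 * M + 2)).
have M2 : 0 < 2 * M + 2 by lra.
have t0 : 0 < t.
  by rewrite lt_min divr_gt0//= divr_gt0// lt_min ltr01 divr_gt0.
have te : t <= e / 4 by rewrite /t ge_min lexx.
have tM : t * (2 * M + 2) <= Num.min 1 (delta / 2).
  by rewrite -ler_pdivlMr// /t ge_min lexx orbT.
move: tM; rewrite le_min => /andP[tM1 tMd].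
pose g : bfun S Y := sphere_inclusion X + of_real s t *: f.
pose N := re `|g|.
have NPhi : 1 + t * re (Phi f) <= N.
  have -> : 1 + t * re (Phi f) = re (Phi g).
    by rewrite /g linearD linearZ /= PhiJ reD reZ -(of_real1 R s) of_realK.
  exact: le_trans (re_le_norm _) (dual_norm1_le _ Phi1).
have PhiM : - M <= re (Phi f).
  rewrite -lerN2 opprK -reN; apply: le_trans (re_le_norm _) _; rewrite normrN.
  exact: dual_norm1_le.
have tPhi : t * - M <= t * re (Phi f) by rewrite ler_wpM2l// ltW.
have tt : t * t <= t by rewrite ger_pMr//; nra.
(* If the sphere were empty, N would be 0, which the choice of t excludes. *)
have [x0 gx0] : exists x0 : S, N - t * t < re `|g x0|.
  apply: contrapT => nx0; have : N <= N - t * t.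
    rewrite {1}/N [`|g|]/(of_real s _) of_realK; apply: sup_norm_le => [|x _].
      nra.
    by rewrite leNgt; apply/negP => gx; apply: nx0; exists x.
  by rewrite lerBrDl gerDr leNgt mulr_gt0.
have gx0E : g x0 = \val x0 + of_real s t *: f x0 by [].
have gx0_neq0 : g x0 != 0.
  apply/eqP => g0; move: gx0; rewrite g0 normr0 -(of_real0 R s) of_realK; nra.
have [phi0 phi01 phi0g] := norming gx0_neq0.
have phi0E : re (phi0 (\val x0)) + t * re (phi0 (f x0)) = re `|g x0|.
  by rewrite -phi0g gx0E linearD linearZ /= reD reZ.
have phi0le y : re (phi0 y) <= re `|y|.
  exact: le_trans (re_le_norm _) (dual_norm1_le _ phi01).
have phi0x : re (phi0 (\val x0)) <= 1.
  by apply: le_trans (phi0le _) _; rewrite norm_sphere -(of_real1 R s) of_realK.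
have phi0f : t * re (phi0 (f x0)) <= t * M.
  by apply: ler_wpM2l; [exact: ltW|exact: le_trans (phi0le _) (bfun_ub _ _)].
have [|x [phi [xphi x0x phi0phi]]] := bpbd x0 phi0 phi01; first nra.
exists (phi (f x)); first by exists (x, phi).
have phi0phi_le : re (phi0 (f x0)) <= re (phi (f x0)) + e / 4.
  rewrite -lerBlDl -reN -reD; apply: le_trans (re_le_norm _) _.
  apply: le_trans (dual_le_norm (phi0 - phi) (f x0)) _.
  apply: le_trans e1M; apply: ler_pM; try exact: re_norm_ge0.
    by rewrite -(ler_of_real s) ge0_reK// ltW.
  exact: bfun_ub.
have phi_le : re (phi (f x0)) <= re (phi (f x)) + e / 4.
  rewrite -lerBlDl -reN -reD -linearB; apply: le_trans (re_le_norm _) _.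
  apply: le_trans (dual_norm1_le _ xphi.1) _.
  apply: fd1; apply: lt_le_trans x0x _.
  by rewrite ler_of_real /e1 ge_min lexx.
have : t * (re (Phi f) - t) <= t * re (phi0 (f x0)) by lra.
by rewrite ler_pM2l//; lra.
Qed.

End NumericalRanges.

Theorem theorem4p3 (R : realType) (s : scalars)
  (Y : completeNormedModType (scalar_field R s)) (X : set Y)
  (X_submod : submod_closed [in X]) (X_closed : closed X)
  (XY_BPB : BPB_pair X)
  (f : bfun (unit_sphere X) Y) (f_uc : unif_continuous (f : unit_sphere X -> Y)) :
  closed_convex_hull (spatial_range f) = intrinsic_range f.
Proof.
have J1 := norm_sphere_inclusion X.
rewrite eqEsubset; split=> [l|_ [Phi PhiJ <-]].
  apply; split; last exact: spatial_sub_intrinsic.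
  by split; [exact: state_values_closed|exact: state_values_convex].
(* The uniformity of the sphere is the one induced by its inclusion in Y. *)
have fuc e : 0 < e -> exists2 d : R, 0 < d & forall x y : unit_sphere X,
     `|\val x - \val y| < of_real s d -> re `|f x - f y| <= e.
  move=> e0; have es0 : 0 < of_real s e by rewrite -(of_real0 R s) ltr_of_real.
  have [U entU Uf] := f_uc _ (entourage_ball _ (PosNum es0)).
  move: entU; rewrite -entourage_ballE => -[d /= d0 dU].
  exists (re d) => [|x y xyd].
    by rewrite -(ltr_of_real s) of_real0 ge0_reK// ltW.
  have := Uf (x, y) (dU (\val x, \val y) _).
  rewrite /= -!ball_normE/= -(ge0_reK (ltW d0)) => /(_ xyd) fxy.
  by rewrite -(ler_of_real s) ge0_reK// ltW.
apply: (@mem_closed_convex_hull _ _ _ (re `|f|))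
  => [_ [[x phi] [phi1 _] <-]|m e e0].
  exact: le_trans (dual_norm1_le _ phi1) (bfun_ub _ _).
have [|_ [[x phi] xphi <-]] :=
  @spatial_support R s Y X (m *: f) Phi e XY_BPB _ PhiJ e0.
  move=> r r0; have m0 : 0 < 1 + re `|m|.
    by rewrite ltr_pwDl//; exact: re_abs_ge0.
  have [d d0 df] := fuc _ (divr_gt0 r0 m0); exists d => // x y /df fxy.
  have -> : (m *: f) x - (m *: f) y = m *: (f x - f y) by rewrite scalerBr.
  rewrite re_normZ; apply: (@le_trans _ _ ((1 + re `|m|) * re `|f x - f y|)).
    by rewrite ler_wpM2r ?re_norm_ge0// lerDr.
  by rewrite mulrC -ler_pdivlMr.
rewrite linearZ => /= le; exists (phi (f x)); first by exists (x, phi).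
by move: le; rewrite linearZ.
Qed.
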